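(* For every positive integer $t$, $$\binom{t+2}{2}\le HG(t,QA^1_1)\le \max\left(t^2-t+3,\binom{t+2}{2}\right).$$
   Context: A family of sets is a set $F$ of sets. $QA^1_1$ is the class of families $F$ such that $|A\cap B|\le 1$ for all distinct $A,B\in F$. A set $X$ with $|X|\le t$ is a $t$-transversal of $F$ if $X\cap A\neq\emptyset$ for every $A\in F$. $HG(t,F)$ is the least nonnegative integer $k$ such that if every subfamily $P\subseteq F$ with $|P|\le k$ has a $t$-transversal then $F$ has a $t$-transversal ($\infty$ if none exists); for a class $\mathcal C$, $HG(t,\mathcal C)=\sup_{F\in\mathcal C}HG(t,F)$. *)

(* Defs.v *)
From mathcomp Require Import all_boot all_order all_algebra.
From mathcomp Require Import all_classical all_reals ereal.

Set Implicit Arguments.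
Unset Strict Implicit.
Unset Printing Implicit Defensive.

Import Order.TTheory GRing.Theory Num.Theory.

Local Open Scope classical_set_scope.
Local Open Scope card_scope.

(* [A #<= `I_n] says that [A] is finite with at most [n] elements, where
   [`I_n] is the set of naturals smaller than [n].
   A family of sets is an [F : set (set T)] over an arbitrary ground type [T];
   neither [F] nor its members are assumed finite. *)

(* A class of families ranges over all ground types. *)
Definition family_class := forall T : Type, set (set (set T)).

Definition QA11 : family_class := fun T =>
  [set F | forall A B : set T, F A -> F B -> A <> B -> A `&` B #<= `I_1].

Definition is_transversal (T : Type) (t : nat) (F : set (set T)) (X : set T) :
    Prop :=
  X #<= `I_t /\ forall A, F A -> X `&` A !=set0.

Definition has_transversal (T : Type) (t : nat) (F : set (set T)) : Prop :=
  exists X : set T, is_transversal t F X.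

Definition HG_property (T : Type) (t : nat) (F : set (set T)) (k : nat) :
    Prop :=
  (forall P : set (set T), P `<=` F -> P #<= `I_k -> has_transversal t P) ->
  has_transversal t F.

Definition HG (R : realType) (T : Type) (t : nat) (F : set (set T)) : \bar R :=
  match pselect (exists k, `[< HG_property t F k >]) with
  | left ex => ((ex_minn ex)%:R)%:E%R
  | right _ => +oo%E
  end.

Definition HG_class (R : realType) (t : nat) (C : family_class) : \bar R :=
  ereal_sup [set x | exists (T : Type) (F : set (set T)),
                       C T F /\ x = HG R t F].

(* Main.v *)
Require Import Defs.
From mathcomp Require Import all_boot all_order all_algebra zify.
From mathcomp Require Import all_classical all_reals ereal.
(* Restores the finite-set meaning of names such as cover and subsetP. *)
From mathcomp Require Import fintype finset.

(* Lower bound: the edges of the complete graph on t + 2 vertices have no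
   t-transversal, but deleting one edge leaves the t other vertices as one.

   Upper bound, by induction on t. If some x lies in t + 1 members, any
   t-transversal of these contains x, so add them to a subfamily without
   (t-1)-transversal of the members avoiding x. Otherwise all degrees are at
   most t, hence t^2 + 1 members have no t-transversal and there is a finite
   critical subfamily. Dually, it is a partial linear space on a finite set V of points,
   with lines of size at most t, such that every V \ {p} is the union of a
   set X_p of at most t lines. If |V| >= t^2 - t + 4, each X_p has at least
   three full lines (lines of size t), and no full line belongs to X_p and X_q
   for p <> q. Counting pairs of points on the resulting 3|V| full lines gives
   3 t (t - 1) <= |V| - 1 <= t^2, a contradiction. *)

Set Implicit Arguments.
Unset Strict Implicit.
Unset Printing Implicit Defensive.

Import Order.TTheory GRing.Theory Num.Theory.

(** * Covers in finite partial linear spaces *)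

Definition linear_lines (V : finType) (L : {set {set V}}) :=
  {in L &, forall A B, A != B -> #|A :&: B| <= 1}.

(** Off [W], only the lines of [X] outside [S] can contribute. It is applied with [S] a few lines of
    [X] and [W] their union. *)
Lemma card_cover_le (V : finType) (X S : {set {set V}}) (W : {set V}) :
  {in S, forall x : {set V}, x \subset W} ->
  #|cover X| <= #|W| + \sum_(x in X :\: S) #|x :\: W|.
Proof.
move=> SW; apply: (@leq_trans #|W :|: \bigcup_(x in X :\: S) (x :\: W)|).
  apply/subset_leq_card/subsetP => v /bigcupP[x xX vx]; rewrite inE.
  case: (boolP (v \in W)) => //= vW; apply/bigcupP; exists x; last first.
    by rewrite inE vW.
  rewrite inE xX andbT; apply: contra vW => /SW /subsetP; exact.
apply: leq_trans (leq_card_setU _ _) _; rewrite leq_add2l.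
apply: (big_ind2 (fun (A : {set V}) n => #|A| <= n)) => //.
  by rewrite cards0.
move=> A m B n Am Bn; apply: leq_trans (leq_card_setU _ _) _.
exact: leq_add.
Qed.

Lemma card_cover_leq_mul (V : finType) (X : {set {set V}}) (t : nat) :
  {in X, forall x : {set V}, #|x| <= t} -> #|cover X| <= #|X| * t.
Proof.
move=> Xt; apply: leq_trans (leq_card_cover X) _.
by rewrite -sum_nat_const; apply: leq_sum => x /Xt.
Qed.

(** A line of [X] meets [x] in at most one point, so covering [x :\ q] takes at least [#|x :\ q|]
    lines of [X] that meet [x]; only the remaining ones can miss it. *)
Lemma card_missed_lines (V : finType) (L X : {set {set V}}) (x : {set V})
    (q : V) :
  linear_lines L -> X \subset L -> x \in L -> x \notin X ->
  x :\ q \subset cover X ->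
  #|[set z in X | [disjoint z & x]]| + #|x :\ q| <= #|X|.
Proof.
move=> Llin XL xL xX /subsetP xqX.
have card_xq : #|x :\ q| <= \sum_(z in X) ~~ [disjoint z & x].
  apply: (@leq_trans #|\bigcup_(z in X) (z :&: x)|).
    apply/subset_leq_card/subsetP => v vxq.
    have /bigcupP[z zX vz] := xqX v vxq; apply/bigcupP; exists z => //.
    by move: vxq; rewrite !inE vz => /andP[].
  apply: (big_ind2 (fun (A : {set V}) n => #|A| <= n)).
  - by rewrite cards0.
  - move=> A m B n Am Bn; apply: leq_trans (leq_card_setU _ _) _.
    exact: leq_add.
  move=> z zX; rewrite -setI_eq0; case: eqVneq => [->|_]; first by rewrite cards0.
  apply: Llin => //; first exact: (subsetP XL).
  by apply: contraNneq xX => <-.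
rewrite -[leqRHS]sum1_card cardsE -sum1_card big_mkcondr.
apply: leq_trans (leq_add (leqnn _) card_xq) _.
rewrite -big_split /=; apply: leq_sum => z _.
by case: [disjoint z & x].
Qed.

Lemma card_setD_meet (V : finType) (x W : {set V}) (t : nat) :
  #|x| <= t -> ~~ [disjoint x & W] -> #|x :\: W| <= t.-1.
Proof.
move=> xt; rewrite -setI_eq0 -card_gt0 => xW.
by rewrite -ltnS prednK ?(leq_trans _ xt) -?(cardsID W x) ?addn_gt0 ?xW //
  -add1n leq_add2r.
Qed.

Lemma card_setD_lt (V : finType) (x W : {set V}) (t : nat) :
  #|x| < t -> #|x :\: W| <= t.-1.
Proof.
by case: t => // t; rewrite ltnS; apply: leq_trans; apply/subset_leq_card/subsetDl.
Qed.

Lemma sqrn_subn n : n ^ 2 - n = n * n.-1.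
Proof. by rewrite -mulnn -subn1 mulnBr muln1. Qed.

(* Every line x of X outside Y is met by all but at most t - |x \ q| of the
   lines of Y. If a full line y lies in both X and Y, this forces so many
   intersections inside X that cover X has at most t^2 - t + 2 points. *)
Lemma full_line_unique (V : finType) (L X Y : {set {set V}}) (t : nat)
    (p q : V) (y : {set V}) :
  linear_lines L -> {in L, forall x : {set V}, #|x| <= t} ->
  X \subset L -> #|X| <= t -> cover X = [set~ p] ->
  Y \subset L -> #|Y| <= t -> cover Y = [set~ q] ->
  t ^ 2 - t + 4 <= #|V| -> q != p ->
  y \in X -> #|y| = t -> y \notin Y.
Proof.
move=> Llin Lt XL Xt pX YL Yt qY nV qp yX yt; apply/negP => yY.
have memXL x : x \in X -> x \in L by move/(subsetP XL).
have cardX : t ^ 2 - t + 3 <= #|cover X|.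
  by rewrite pX cardsC1; move: nV; clear; lia.
have /bigcupP[x0 x0X qx0] : q \in cover X.
  by rewrite pX !inE.
have qNmem z : z \in Y -> q \notin z.
  move=> zY; apply/negP => qz; have : q \in cover Y by apply/bigcupP; exists z.
  by rewrite qY !inE eqxx.
have x0Y : x0 \notin Y by apply: contraL qx0; exact: qNmem.
have qy : q \notin y by exact: qNmem.
have subY (x : {set V}) : x :\ q \subset cover Y.
  by rewrite qY; apply/subsetP => v; rewrite !inE => /andP[].
have cardDmeet (x W : {set V}) : x \in X -> ~~ [disjoint x & W] ->
    #|x :\: W| <= t.-1.
  by move=> /memXL /Lt; exact: card_setD_meet.
have cardDnfull (x W : {set V}) : x \in X -> #|x| != t -> #|x :\: W| <= t.-1.
  by move=> /memXL /Lt xt xnt; apply: card_setD_lt; rewrite ltn_neqAle xnt.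
have meetq (x W : {set V}) : q \in x -> q \in W -> ~~ [disjoint x & W].
  by move=> qx qW; apply/negP => /disjointFr /(_ qx); rewrite qW.
(* Covering the [t] points of such an [r] takes [t] lines of [Y], which exhausts [Y]. *)
have full_meets (r z : {set V}) :
    r \in X -> #|r| = t -> r \notin Y -> q \notin r -> z \in Y ->
    ~~ [disjoint z & r].
  move=> rX rt rY qr zY.
  have := card_missed_lines Llin YL (memXL r rX) rY (subY r).
  have -> : r :\ q = r by apply/setDidPl; rewrite disjoint_sym disjoints1.
  rewrite rt => miss; apply/negP => zr.
  have : 0 < #|[set z in Y | [disjoint z & r]]|.
    by rewrite card_gt0; apply/set0Pn; exists z; rewrite inE zY.
  by move: miss Yt; clear; lia.
have [/existsP[r /and4P[rX /eqP rt rY qr]]|] :=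
    boolP [exists r : {set V}, [&& r \in X, #|r| == t, r \notin Y & q \notin r]].
- (* Every full line of X meets the union of r, y and x0. *)
  have yr : y != r by apply: contraNneq rY => <-.
  have x0r : x0 != r by apply: contraNneq qr => <-.
  have x0y : x0 != y by apply: contraNneq qy => <-.
  have meet_yr := full_meets r y rX rt rY qr yY.
  set W := r :|: y :|: x0.
  have cardW : #|W| <= t + t.-1 + t.
    apply: leq_trans (leq_card_setU _ _) _.
    apply: leq_add; last exact: Lt (memXL _ x0X).
    have -> : r :|: y = r :|: y :\: r by rewrite setDE setUIr setUCr setIT.
    apply: leq_trans (leq_card_setU _ _) _.
    by rewrite rt leq_add2l cardDmeet.
  have SW : {in [set r; y; x0], forall x : {set V}, x \subset W}.
    move=> x; rewrite !inE -orbA => /or3P[] /eqP->; apply/subsetP => v vx;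
      by rewrite !inE vx ?orbT.
  have cardS : #|X :\: [set r; y; x0]| <= t - 3.
    have SX : [set r; y; x0] \subset X.
      by apply/subsetP => x; rewrite !inE -orbA => /or3P[] /eqP->.
    rewrite cardsD (setIidPr SX).
    have -> : #|[set r; y; x0]| = 3.
      by rewrite setUC cardsU1 cards2 !inE (negPf x0r) (negPf x0y) eq_sym yr.
    exact: leq_sub2r.
  have sum_le : \sum_(x in X :\: [set r; y; x0]) #|x :\: W| <= (t - 3) * t.-1.
    apply: (@leq_trans (\sum_(x in X :\: [set r; y; x0]) t.-1)).
      apply: leq_sum => x; rewrite inE => /andP[_ xX].
      have [xt|] := eqVneq #|x| t; last exact: cardDnfull.
      apply: cardDmeet => //.
      (* A full line in [Y] meets [r]; a line through [q] meets [x0]; any other full line of [X]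
         qualifies for [full_meets] in place of [r], hence meets [y]. *)
      have [xY|xY] := boolP (x \in Y).
        have := full_meets r x rX rt rY qr xY; apply: contra => /disjointWr-> //.
        by apply/subsetP => v; rewrite !inE => ->.
      have [qx|qx] := boolP (q \in x).
        by apply: meetq qx _; rewrite !inE qx0 orbT.
      have := full_meets x y xX xt xY qx yY; rewrite disjoint_sym.
      apply: contra => /disjointWr-> //.
      by apply/subsetP => v; rewrite !inE => ->; rewrite orbT.
    by rewrite sum_nat_const leq_mul2r cardS orbT.
  have t3 : 2 < t.
    apply: leq_trans Xt.
    have <- : #|[set r; y; x0]| = 3.
      by rewrite setUC cardsU1 cards2 !inE (negPf x0r) (negPf x0y) eq_sym yr.
    by apply/subset_leq_card/subsetP => x; rewrite !inE -orbA => /or3P[] /eqP->.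
  (* The upper bound is (3t - 1) + (t - 3)(t - 1) = t^2 - t + 2, one short of [cardX]. *)
  have := leq_trans cardX (leq_trans (card_cover_le X SW) (leq_add cardW sum_le)).
  by move: t3; clear; rewrite sqrn_subn; case: t => [|[|[|t]]] // _;
    rewrite !subSS subn0 /= => bound; nia.
- (* Every full line of X that misses x0 belongs to Y. *)
  rewrite negb_exists => /forallP noB.
  have SW : {in [set x0], forall x : {set V}, x \subset x0}.
    by move=> x; rewrite inE => /eqP->.
  have sum_le : \sum_(x in X :\ x0) #|x :\: x0| <=
      t.-1 * t.-1 + #|[set z in Y | [disjoint z & x0]]|.
    apply: (@leq_trans (\sum_(x in X :\ x0)
        (t.-1 + ((x \in Y) && [disjoint x & x0])))).
      apply: leq_sum => x; rewrite inE => /andP[_ xX].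
      have [xx0|] := boolP [disjoint x & x0]; last first.
        by move=> xx0; rewrite andbF addn0 cardDmeet.
      have [xt|xt] := eqVneq #|x| t; last first.
        by apply: leq_trans (leq_addr _ _); exact: cardDnfull.
      have qx : q \notin x by apply: contraL xx0 => qx; exact: meetq.
      have xY : x \in Y.
        by have := noB x; rewrite xX xt eqxx qx /= andbT negbK.
      rewrite xY /= addn1; apply: leq_trans (leqSpred _).
      by rewrite -xt; apply/subset_leq_card/subsetDl.
    rewrite big_split /= sum_nat_const; apply: leq_add.
      rewrite leq_mul2r; apply/orP; right.
      by move: Xt; rewrite (cardsD1 x0 X) x0X; clear; case: t.
    rewrite -sum1_card [leqRHS]big_mkcond [leqLHS]big_mkcond /=.
    apply: leq_sum => x _; rewrite !inE.
    by case: ifP => // _; case: ifP => // ->.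
  (* At most t - (|x0| - 1) lines of [Y] miss [x0], so the cover has at most |x0| + (t - 1)^2 + t -
     |x0| + 1 = t^2 - t + 2 points, again one short of [cardX]. *)
  have miss := card_missed_lines Llin YL (memXL x0 x0X) x0Y (subY x0).
  have := leq_trans cardX (leq_trans (card_cover_le X SW) (leq_add (leqnn _) sum_le)).
  have := cardsD1 q x0; rewrite qx0 => ->.
  have t0 : 0 < t by apply: leq_trans Xt; rewrite card_gt0; apply/set0Pn; exists y.
  move: miss Yt t0; clear; move: #|_| #|_| #|_| => a b c.
  by rewrite sqrn_subn; case: t => // t /= m b0 _ bound; nia.
Qed.

(** Double counting of ordered pairs of distinct points on a common line: no pair lies on two lines.
    Around a fixed [u], the lines through [u] are disjoint apart from [u], so they have at most
    [#|V|.-1] other points in total. *)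
Lemma full_lines_card_le (V : finType) (L : {set {set V}}) (t : nat) :
  linear_lines L -> {in L, forall x : {set V}, #|x| = t} ->
  #|L| * (t * t.-1) <= #|V| * #|V|.-1.
Proof.
move=> Llin Lt.
have card_le u : \sum_(y in L | u \in y) t.-1 <= #|V|.-1.
  rewrite -(cardsC1 u) -sum1_card.
  apply: (@leq_trans (\sum_(v in [set~ u]) \sum_(y in L | u \in y) (v \in y))).
    rewrite exchange_big /=; apply: leq_sum => y /andP[yL uy].
    rewrite -(Lt y yL) (cardsD1 u) uy /= -sum1_card big_mkcond [leqRHS]big_mkcond.
    by apply: leq_sum => v _; rewrite !inE; case: (v != u) => //=; case: (v \in y).
  apply: leq_sum => v; rewrite !inE => vu.
  rewrite -big_mkcondr sum1dep_card; apply/card_le1_eqP => z y.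
  rewrite !inE => /andP[/andP[zL uz] vz] /andP[/andP[yL uy] vy].
  apply/eqP/negPn/negP => yz; have := Llin y z yL zL yz.
  apply/negP; rewrite -ltnNge; apply: (@leq_trans #|[set u; v]|).
    by rewrite cards2 eq_sym vu.
  by apply/subset_leq_card/subsetP => w; rewrite !inE => /orP[] /eqP->; apply/andP.
apply: (@leq_trans (\sum_u \sum_(y in L | u \in y) t.-1)); last first.
  by rewrite -sum_nat_const; apply: leq_sum => u _.
rewrite (exchange_big_dep (mem L)) /=; last by move=> u y _ /andP[].
rewrite -sum_nat_const; apply: leq_sum => y yL.
by rewrite (eq_bigl (mem y)) ?sum_nat_const ?Lt // => u; rewrite yL.
Qed.

Lemma critical_card_le (V : finType) (L : {set {set V}}) (t : nat) :
  linear_lines L -> {in L, forall x : {set V}, #|x| <= t} ->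
  (forall p, exists X : {set {set V}},
     [/\ X \subset L, #|X| <= t & cover X = [set~ p]]) ->
  #|V| <= t ^ 2 - t + 3.
Proof.
move=> Llin Lt /fin_all_exists[X XP]; rewrite leqNgt; apply/negP => nV.
have {nV} nV : t ^ 2 - t + 4 <= #|V| by move: nV; clear; lia.
pose C p := [set x in X p | #|x| == t].
have XL p x : x \in X p -> x \in L by case: (XP p) => /subsetP XL _ _ /XL.
(* Each line of [X p] covers at most [t.-1] points, plus one if it is full. *)
have card_V p : #|V|.-1 <= t * t.-1 + #|C p|.
  have [_ Xt Xp] := XP p; rewrite -(cardsC1 p) -Xp.
  apply: leq_trans (leq_card_cover _) _.
  apply: (@leq_trans (\sum_(x in X p) (t.-1 + (#|x| == t)))).
    apply: leq_sum => x /XL /Lt; case: eqVneq => [->|xt]; first by rewrite addn1 leqSpred.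
    by rewrite addn0 leq_eqVlt (negPf xt) /=; case: (t).
  rewrite big_split /= sum_nat_const leq_add ?leq_mul2r ?Xt ?orbT //.
  rewrite -sum1_card [leqLHS]big_mkcond [leqRHS]big_mkcond.
  by apply: leq_sum => x _; rewrite inE; case: (x \in X p); case: (#|x| == t).
have C3 p : 3 <= #|C p|.
  by move: (card_V p) nV; rewrite sqrn_subn; clear; lia.
have disjC p q : p != q -> [disjoint C p & C q].
  rewrite eq_sym => qp; apply/pred0P => y /=; apply/negP => /andP[].
  rewrite !inE => /andP[yX /eqP yt] /andP[yY _].
  have [[XpL Xpt Xp] [XqL Xqt Xq]] := (XP p, XP q).
  have := full_line_unique Llin Lt XpL Xpt Xp XqL Xqt Xq nV qp yX yt.
  by rewrite yY.
have /full_lines_card_le lin : linear_lines (\bigcup_p C p).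
  move=> x y /bigcupP[p _ xp] /bigcupP[q _ yq]; apply: Llin.
    by move: xp; rewrite inE => /andP[/XL].
  by move: yq; rewrite inE => /andP[/XL].
have {}lin := lin t _.
have : #|\bigcup_p C p| * (t * t.-1) <= #|V| * #|V|.-1.
  by apply: lin => x /bigcupP[p _]; rewrite inE => /andP[_ /eqP].
have : #|V| * 3 <= #|\bigcup_p C p|.
  rewrite -[leqRHS]sum1_card partition_disjoint_bigcup //.
  by rewrite -sum_nat_const; apply: leq_sum => p _; rewrite sum1_card.
have : #|V|.-1 <= t * t.
  have /card_gt0P[p _] : 0 < #|V| by move: nV; clear; lia.
  have [XpL Xt Xp] := XP p; rewrite -(cardsC1 p) -Xp.
  apply: (leq_trans (@card_cover_leq_mul _ _ t _)); first by move=> x /XL /Lt.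
  by rewrite leq_mul2r Xt orbT.
(* Cancelling |V| leaves 3t(t - 1) <= |V| - 1 <= t^2, so t <= 1 and |V| <= 2, against |V| >= 4. *)
move: nV; rewrite sqrn_subn; move: #|V| #|\bigcup_p C p|; clear => -[|n] c.
  by rewrite addnC.
case: t => [|t] /=; first by lia.
move=> n1 n2 n3 n4.
have {n3 n4} : n.+1 * (3 * (t.+1 * t)) <= n.+1 * n.
  by rewrite mulnA; apply: leq_trans n4; rewrite leq_mul2r n3 orbT.
by rewrite leq_pmul2l // => n3; nia.
Qed.

(** * Cardinal bounds and transversals through slots *)

(** Slots may be empty, repeated or filled from outside [A]. This allows an empty ground type, and
    lists can be extended or joined without tracking injectivity. *)
Lemma card_le_IP (T : Type) (A : set T) (n : nat) :
  (A #<= `I_n)%card <->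
  exists h : 'I_n -> option T, forall x, A x -> exists i, h i = Some x.
Proof.
split=> [/pcard_leP[f]|[h hA]].
  exists (fun i : 'I_n => match pselect (exists x, A x /\ f x = i) with
            | left e => Some (projT1 (cid e)) | right _ => None end) => x Ax.
  have fxn : f x < n by exact: (@funS _ _ _ _ f x Ax).
  exists (Ordinal fxn); case: pselect => [e|[]]; last by exists x.
  case: (cid e) => /= y [Ay fyx]; congr Some.
  by apply: (@inj _ _ _ f) fyx; rewrite in_setE.
pose h' k := if insub k is Some i then h i else None.
rewrite -(card_le_eql (@card_some _ A)).
apply: card_le_trans (card_image_le h' `I_n).
apply: subset_card_le => _ [x Ax <-].
have [i hi] := hA x Ax; exists (val i); first exact: ltn_ord.
by rewrite /h' valK.
Qed.

Lemma card_le_I1_eq (T : Type) (A : set T) (x y : T) :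
  (A #<= `I_1)%card -> A x -> A y -> x = y.
Proof.
move=> /card_le_IP[h hA] /hA[i hx] /hA[j hy].
by move: hx; rewrite (ord1 i) -(ord1 j) hy => -[].
Qed.

Lemma card_le_finset (V : finType) (B : {set V}) :
  ([set` B] #<= `I_#|B|)%card.
Proof.
apply/card_le_IP; exists (fun i => Some (enum_val i)) => x /= xB.
by exists (enum_rank_in xB x); rewrite enum_rankK_in.
Qed.

Lemma card_slots_le (V : finType) (n : nat) (h : 'I_n -> option V) :
  #|[set x | [exists i, h i == Some x]]%SET| <= n.
Proof.
have Sinj : injective (@Some V) by move=> x y [].
rewrite -[leqRHS]card_ord -(card_imset _ Sinj).
apply: leq_trans (leq_imset_card h _); apply/subset_leq_card/fintype.subsetP => y.
move=> /imsetP[x xh ->]; move: xh; rewrite inE => /existsP[i /eqP <-].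
exact: imset_f.
Qed.

Lemma has_transversalP (T : Type) (t : nat) (F : set (set T)) :
  has_transversal t F <-> exists h : 'I_t -> option T,
    forall A, F A -> exists i x, h i = Some x /\ A x.
Proof.
split=> [[X [/card_le_IP[h hX] XF]]|[h hF]].
  exists h => A /XF[x [/hX[i hi] Ax]]; by exists i, x.
exists [set x | exists i, h i = Some x]%classic; split.
  by apply/card_le_IP; exists h.
by move=> A /hF[i [x [hi Ax]]]; exists x; split => //; exists i.
Qed.

(** * The dual partial linear space of a family *)

(* The set of members of the family passing through x; in the dual picture
   the members are points and x is a line. *)
Definition line (T : Type) (n : nat) (A : 'I_n -> set T) (x : T) : {set 'I_n} :=
  [set i | `[< A i x >]]%SET.

Definition lines_of (T : Type) (n t : nat) (A : 'I_n -> set T)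
    (h : 'I_t -> option T) : {set {set 'I_n}} :=
  [set B | [exists i, omap (line A) (h i) == Some B]]%SET.

(** The duality dictionary: piercing members by chosen elements amounts to covering indices by the
    chosen lines. *)
Lemma mem_cover_lines (T : Type) (n t : nat) (A : 'I_n -> set T)
    (h : 'I_t -> option T) (j : 'I_n) :
  (exists i x, h i = Some x /\ A j x) <-> j \in cover (lines_of A h).
Proof.
split=> [[i [x [hi Ajx]]]|/bigcupP[B]].
  apply/bigcupP; exists (line A x); last by rewrite inE; apply/asboolP.
  by rewrite inE; apply/existsP; exists i; rewrite hi.
rewrite inE => /existsP[i]; case hi: (h i) => [x|] //= /eqP[<-].
by rewrite inE => /asboolP Ajx; exists i, x.
Qed.

Lemma QA11_meet_eq (T : Type) (F : set (set T)) (A B : set T) (x y : T) :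
  QA11 F -> F A -> F B -> A <> B -> A x -> B x -> A y -> B y -> x = y.
Proof.
by move=> FQ FA FB AB Ax Bx Ay By; apply: (card_le_I1_eq (FQ A B FA FB AB)).
Qed.

(** Two indices common to the lines of [x] and [y] would put both elements in two members, forcing
    [x = y]. A transversal of all members but the [p]-th gives lines covering exactly [[set~ p]], as
    covering [p] too would pierce the whole family. *)
Lemma critical_family_card_le (T : Type) (t n : nat) (A : 'I_n -> set T) :
  QA11 (range A) -> injective A -> (forall x, #|line A x| <= t) ->
  ~ has_transversal t (range A) ->
  (forall i, has_transversal t (A @` [set j | j <> i])%classic) ->
  n <= t ^ 2 - t + 3.
Proof.
move=> AQ Ainj At Ant Acrit; rewrite -[n]card_ord.
pose L := [set B : {set 'I_n} | `[< exists x, B = line A x >]]%SET.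
apply: (@critical_card_le _ L) => [B C|B|p].
- rewrite !inE => /asboolP[x ->] /asboolP[y ->] xy.
  apply/card_le1_eqP => i j; rewrite !inE.
  move=> /andP[/asboolP ix /asboolP iy] /andP[/asboolP jx /asboolP jy].
  apply: contrapT => ij; move/eqP: xy; apply; congr line.
  apply: (QA11_meet_eq AQ (_ : range A (A j)) (_ : range A (A i))) => //.
  by move/Ainj.
- by rewrite inE => /asboolP[x ->].
have /has_transversalP[h hA] := Acrit p; exists (lines_of A h); split.
- apply/fintype.subsetP => B; rewrite !inE => /existsP[i].
  by case: (h i) => //= x /eqP[<-]; apply/asboolP; exists x.
- exact: card_slots_le.
apply/eqP; rewrite eqEsubset; apply/andP; split; last first.
  apply/fintype.subsetP => j; rewrite !inE => /eqP jp.
  by apply/mem_cover_lines/hA; exists j.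
rewrite finset.subsetC finset.sub1set inE; apply/negP => pX; apply: Ant.
apply/has_transversalP; exists h => _ [j _ <-].
have [->|/eqP jp] := eqVneq j p; first exact/mem_cover_lines.
by apply: hA; exists j.
Qed.

(** * Upper bound by induction on the transversal size *)

(** The contrapositive of [HG_property t F N], uniformly over the families in [QA11] on [T]: it
    produces a small witness, which the induction can enlarge. *)
Definition helly_bound (T : Type) (t N : nat) : Prop :=
  forall F : set (set T), QA11 F -> ~ has_transversal t F ->
  exists P, [/\ (P `<=` F)%classic, (P #<= `I_N)%card & ~ has_transversal t P].

Lemma helly_bound_le (T : Type) (t M N : nat) :
  M <= N -> helly_bound T t M -> helly_bound T t N.
Proof.
move=> MN HM F FQ Fnt; have [P [PF PM Pnt]] := HM F FQ Fnt.
by exists P; split => //; apply: card_le_trans PM _; rewrite card_le_II.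
Qed.

Lemma helly_bound0 (T : Type) : helly_bound T 0 1.
Proof.
move=> F FQ Fnt.
have [A FA] : exists A, F A.
  apply: contrapT => F0; apply: Fnt; apply/has_transversalP.
  by exists (fun _ => None) => A FA; case: F0; exists A.
exists [set A]%classic; split => [B ->||] //.
  by apply/card_le_IP; exists (fun _ => Some A) => B ->; exists ord0.
by move/has_transversalP => [h /(_ A erefl)[[]]].
Qed.

Lemma helly_bound_high_degree (T : Type) (t N : nat) (F : set (set T)) (x : T)
    (A : 'I_t.+2 -> set T) :
  helly_bound T t N -> QA11 F -> ~ has_transversal t.+1 F ->
  injective A -> (forall i, F (A i)) -> (forall i, A i x) ->
  exists P, [/\ (P `<=` F)%classic, (P #<= `I_(N + t.+2))%card &
                ~ has_transversal t.+1 P].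
Proof.
move=> HN FQ Fnt Ainj FA Ax.
have [P [PF PN Pnt]] : exists P, [/\ (P `<=` [set B | F B /\ ~ B x])%classic,
    (P #<= `I_N)%card & ~ has_transversal t P].
  apply: HN => [B C [FB _] [FC _]|]; first exact: FQ.
  move=> /has_transversalP[h hF]; apply: Fnt; apply/has_transversalP.
  (* The new slot 0 holds [x] and pierces the members through [x]; [h] pierces the others. *)
  exists (fun i => if unlift ord0 i is Some j then h j else Some x) => B FB.
  have [Bx|Bx] := pselect (B x); first by exists ord0, x; rewrite unlift_none.
  by have [|i iP] := hF B; [split|exists (lift ord0 i); rewrite liftK].
exists (P `|` range A)%classic; split.
- by move=> B [/PF[]|[i _ <-]].
- have /card_le_IP[g gP] := PN; apply/card_le_IP.
  exists (fun i => match split i with inl j => g j | inr j => Some (A j) end).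
  move=> B [/gP[j gj]|[j _ <-]].
    by exists (unsplit (inl j)); rewrite unsplitK.
  by exists (unsplit (inr j)); rewrite unsplitK.
move=> /has_transversalP[h hP].
have [[i0 hi0]|hx] := pselect (exists i, h i = Some x).
  (* Members of [P] avoid [x], so the other [t] slots would already pierce [P]. *)
  apply: Pnt; apply/has_transversalP; exists (h \o lift i0) => B PB.
  have [i [y [hi By]]] := hP B (or_introl PB).
  case: (unliftP i0 i) => [j ij|ii0]; first by exists j, y; rewrite /= -ij.
  by have [_] := PF B PB; case; move: hi; rewrite ii0 hi0 => -[->].
have /fin_all_exists[c cP] (j : 'I_t.+2) : exists i, exists y, h i = Some y /\ A j y.
  by apply: hP; right; exists j.
have /injectivePn[j [k jk cjk]] : ~~ injectiveb c.
  by apply/negP => /injectiveP /leq_card; rewrite !card_ord ltnn.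
have [y [hy Ajy]] := cP j; have [z [hz Akz]] := cP k.
move: hz; rewrite -cjk hy => -[yz]; subst z.
apply: hx; exists (c j); rewrite hy; congr Some.
apply: (QA11_meet_eq FQ (FA j) (FA k)) => // /Ainj jk'.
by rewrite jk' eqxx in jk.
Qed.

Lemma helly_bound_low_degree (T : Type) (t : nat) (F : set (set T)) :
  QA11 F -> ~ has_transversal t F ->
  (forall x (A : 'I_t.+1 -> set T), injective A -> (forall i, F (A i)) ->
     ~ forall i, A i x) ->
  exists P, [/\ (P `<=` F)%classic, (P #<= `I_(t ^ 2 - t + 3))%card &
                ~ has_transversal t P].
Proof.
move=> FQ Fnt Fdeg.
have line_le n (A : 'I_n -> set T) x :
    injective A -> (range A `<=` F)%classic -> #|line A x| <= t.
  move=> Ainj AF; rewrite leqNgt; apply/negP => tA.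
  pose e i := enum_val (widen_ord tA i).
  apply: (Fdeg x (A \o e)) => [i j /Ainj /enum_val_inj /(congr1 val) ij|i|i].
  - exact: val_inj.
  - by apply: AF; exists (e i).
  by have := enum_valP (widen_ord tA i); rewrite inE => /asboolP.
(* The least [n] satisfying [Q] yields the critical subfamily. *)
pose Q n := exists A : 'I_n -> set T,
  [/\ injective A, (range A `<=` F)%classic & ~ has_transversal t (range A)].
have exQ : exists n, `[< Q n >].
  have [[n Fn]|Finf] := pselect (finite_set F).
    have := Fn; rewrite card_eq_sym => /pcard_eqP[f].
    exists n; apply/asboolP; exists (f \o val); split.
    - move=> i j /= fij; apply/val_inj.
      by apply: (@inj _ _ _ f) fij; rewrite in_setE /=.
    - move=> _ [i _ <-]; apply: (@funS _ _ _ _ f); exact: ltn_ord.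
    move=> ft; apply: Fnt; move: ft; congr has_transversal.
    apply/seteqP; split=> [_ [i _ <-]|A FA].
      by apply: (@funS _ _ _ _ f); exact: ltn_ord.
    have [k kn <-] := (@surj _ _ _ _ f A FA).
    by exists (Ordinal kn).
  have /infiniteP /pcard_leP[f] := Finf.
  (* With all degrees at most [t], the elements of a [t]-transversal pierce at most [t * t]
     members. *)
  exists (t * t).+1; apply/asboolP; exists (f \o val).
  have finj : injective (f \o val : 'I_(t * t).+1 -> _).
    by move=> i j /= fij; apply/val_inj; apply: (@inj _ _ _ f) fij; rewrite in_setE.
  have fF : (range (f \o val : 'I_(t * t).+1 -> _) `<=` F)%classic.
    by move=> _ [i _ <-]; apply: (@funS _ _ _ _ f).
  split => // /has_transversalP[h hf].
  set A := f \o val in finj fF hf.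
  have : #|cover (lines_of A h)| <= t * t.
    apply: (leq_trans (@card_cover_leq_mul _ _ t _)).
      move=> B; rewrite inE => /existsP[i]; case: (h i) => //= x /eqP[<-].
      exact: line_le.
    by rewrite leq_mul2r card_slots_le orbT.
  apply/negP; rewrite -ltnNge -[leqLHS]card_ord; apply/subset_leq_card.
  apply/fintype.subsetP => j _; apply/mem_cover_lines; apply: hf; by exists j.
have [n /asboolP[A [Ainj AF Ant]] nmin] := ex_minnP exQ.
exists (range A); split => //.
apply: card_le_trans (_ : `I_n #<= _)%card.
  by apply/card_le_IP; exists (Some \o A) => _ [i _ <-]; exists i.
rewrite card_le_II; apply: (@critical_family_card_le _ _ _ A) => //.
- by move=> B C /AF FB /AF FC; exact: FQ.
- by move=> x; exact: line_le.
case: n => [|n] in A Ainj AF Ant nmin *; first by case.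
move=> i; apply: contrapT => nt.
suff /nmin : `[< Q n >] by rewrite ltnn.
apply/asboolP; exists (A \o lift i); split.
- by move=> j k /Ainj /lift_inj.
- by move=> _ [j _ <-]; apply: AF; exists (lift i j).
move=> Ait; apply: nt; move: Ait; congr has_transversal.
apply/seteqP; split=> [_ [j _ <-]|_ [j /= ji <-]].
  by exists (lift i j) => //= /eqP; rewrite eq_sym (negPf (neq_lift i j)).
by case: (unliftP i j) => [k ->|//]; exists k.
Qed.

Lemma helly_boundS (T : Type) (t N : nat) :
  helly_bound T t N -> helly_bound T t.+1 (maxn (t.+1 ^ 2 - t.+1 + 3) (N + t.+2)).
Proof.
move=> HN F FQ Fnt.
have extend M (P : set (set T)) : (P #<= `I_M)%card ->
    M <= maxn (t.+1 ^ 2 - t.+1 + 3) (N + t.+2) ->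
    (P #<= `I_(maxn (t.+1 ^ 2 - t.+1 + 3) (N + t.+2)))%card.
  by move=> PM MN; apply: card_le_trans PM _; rewrite card_le_II.
have [[x [A [Ainj FA Ax]]]|lowdeg] := pselect (exists x (A : 'I_t.+2 -> set T),
    [/\ injective A, forall i, F (A i) & forall i, A i x]).
  have [P [PF PN Pnt]] := helly_bound_high_degree HN FQ Fnt Ainj FA Ax.
  by exists P; split => //; apply: extend PN _; exact: leq_maxr.
have [|P [PF PN Pnt]] := helly_bound_low_degree FQ Fnt.
  by move=> x A Ainj FA Ax; apply: lowdeg; exists x, A.
by exists P; split => //; apply: extend PN _; exact: leq_maxl.
Qed.

Lemma helly_boundP (T : Type) (t : nat) :
  helly_bound T t.+1 (maxn (t.+1 ^ 2 - t.+1 + 3) 'C(t.+1 + 2, 2)).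
Proof.
elim: t => [|t IH].
  exact: helly_bound_le (helly_boundS (@helly_bound0 T)).
apply: helly_bound_le (helly_boundS IH).
(* By Pascal's rule the binomial grows by exactly the number of members added in the high-degree
   case. *)
have -> : 'C(t.+2 + 2, 2) = 'C(t.+1 + 2, 2) + t.+3.
  by rewrite addSn binS bin1 addn2.
(* From s to s + 1, s^2 - s + 3 grows by 2s, which absorbs the s + 2 added members once s >= 2; the
   step from s = 1 is settled by computation. *)
case: t {IH} => [//|t]; rewrite !sqrn_subn /=; move: 'C(_, _) => c.
rewrite geq_max leq_maxl addn_maxl geq_max !leq_max leqnn !orbT andbT.
by apply/orP; left; nia.
Qed.

(** * Values of [HG] and the complete graph *)

Lemma HG_le (R : realType) (T : Type) (t k : nat) (F : set (set T)) :
  HG_property t F k -> (HG R t F <= k%:R%:E)%E.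
Proof.
rewrite /HG => Fk; case: pselect => [e|[]]; last by exists k; apply/asboolP.
case: ex_minnP => m _ mmin; rewrite lee_fin ler_nat.
by apply: mmin; apply/asboolP.
Qed.

Lemma HG_ge (R : realType) (T : Type) (t k : nat) (F : set (set T)) :
  (forall m, HG_property t F m -> k <= m) -> (k%:R%:E <= HG R t F)%E.
Proof.
move=> Fk; rewrite /HG; case: pselect => [e|_]; last exact: leey.
by case: ex_minnP => m /asboolP /Fk km _; rewrite lee_fin ler_nat.
Qed.

Definition complete_graph (n : nat) : set (set 'I_n) :=
  [set A | exists2 B : {set 'I_n}, #|B| = 2 & A = [set` B]]%classic.

Lemma QA11_complete_graph (n : nat) : QA11 (@complete_graph n).
Proof.
move=> _ _ [B B2 ->] [C C2 ->] BC.
have -> : ([set` B] `&` [set` C] = [set` B :&: C])%classic.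
  by apply/seteqP; split=> x /=; rewrite inE => /andP.
apply: card_le_trans (card_le_finset _) _; rewrite card_le_II leqNgt.
apply/negP => BC2; apply: BC; suff -> : B = C by [].
have <- : B :&: C = B by apply/eqP; rewrite eqEcard subsetIl B2.
by apply/eqP; rewrite eqEcard subsetIr C2.
Qed.

Lemma complete_graph_no_transversal (t : nat) :
  ~ has_transversal t (@complete_graph (t + 2)).
Proof.
move=> /has_transversalP[h hK].
set S := [set x | [exists i, h i == Some x]]%SET.
have : 1 < #|~: S|.
  by have := card_slots_le h; rewrite -/S; have := cardsC S; rewrite card_ord; lia.
move=> /card_gt1P[x [y [xS yS xy]]].
have [|i [z [hi]]] := hK [set` [set x; y]%SET]%classic.
  by exists [set x; y]%SET => //; rewrite cards2 xy.
move=> /= zxy; have : z \in S by rewrite inE; apply/existsP; exists i; rewrite hi.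
move: zxy xS yS; rewrite !in_setC in_set2 => /orP[] /eqP-> xS yS.
  by rewrite (negPf xS).
by rewrite (negPf yS).
Qed.

Lemma complete_graph_sub_transversal (t m : nat) (P : set (set 'I_(t + 2))) :
  (P `<=` @complete_graph (t + 2))%classic -> (P #<= `I_m)%card ->
  m < 'C(t + 2, 2) -> has_transversal t P.
Proof.
move=> PK /card_le_IP[h hP] mt.
pose g i := omap (fun A : set 'I_(t + 2) => [set x | `[< A x >]]%SET) (h i).
(* Fewer slots than edges leave some edge [B] unlisted. *)
have [B B2 Bg] : exists2 B : {set 'I_(t + 2)}, #|B| = 2 & forall i, g i <> Some B.
  apply: contrapT => noB; move: mt; apply/negP; rewrite -leqNgt.
  rewrite -[in X in X <= _](card_ord (t + 2)) -card_draws.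
  apply: leq_trans (card_slots_le g); apply/subset_leq_card/subsetP => B.
  rewrite !inE => /eqP B2; apply: contrapT => /negP; rewrite negb_exists.
  by move=> /forallP Bg; apply: noB; exists B => // i; apply/eqP.
(* The [t] vertices off [B] meet every edge other than [B], since such an edge is not contained in
   [B]. *)
exists [set` (~: B)%SET]%classic; split.
  apply: card_le_trans (card_le_finset _) _; rewrite card_le_II.
  by rewrite -(leq_add2l #|B|) cardsC card_ord B2 addnC.
move=> A PA; have [C C2 AC] := PK A PA.
have /subsetPn[x xC xB] : ~~ (C \subset B).
  apply/negP => CB; have [i hi] := hP A PA; apply: (Bg i).
  rewrite /g hi AC /=; congr Some.
  have <- : C = B by apply/eqP; rewrite eqEcard CB B2 C2.
  by apply/setP => x; rewrite inE; apply/asboolP/idP.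
by exists x; split; rewrite ?AC //= inE.
Qed.

Local Open Scope ring_scope.
Local Open Scope ereal_scope.

Theorem theorem3 (R : realType) (t : nat) (ht : (0 < t)%N) :
  (('C(t + 2, 2)%N)%:R)%:E <= HG_class R t QA11 /\
  HG_class R t QA11 <= ((maxn (t ^ 2 - t + 3) 'C(t + 2, 2))%N%:R)%:E.
Proof.
split.
  apply: (@le_trans _ _ (HG R t (@complete_graph (t + 2)))).
    apply: HG_ge => m Km; rewrite leqNgt; apply/negP => mt.
    apply: (@complete_graph_no_transversal t); apply: Km => P PK Pm.
    exact: complete_graph_sub_transversal PK Pm mt.
  apply: ereal_sup_ubound; exists 'I_(t + 2), (@complete_graph (t + 2)).
  by split => //; exact: QA11_complete_graph.
case: t ht => // t _; apply: ge_ereal_sup => _ [T [F [FQ ->]]].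
apply: HG_le => Fsub; apply: contrapT => /(helly_boundP FQ)[P [PF Pk]]; apply.
exact: Fsub.
Qed.
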